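(* Let $\mathbf{R}$ be a commutative ring with unity, let $x=(x_1,\ldots,x_n)$ and $y=(y_1,\ldots,y_n)$ be variables, let $f(x)=(f_1(x),\ldots,f_n(x))$ be polynomials in $\mathbf{R}[x]$, and let $\delta_f=\sum_{i=1}^n(\deg(f_i)-1)$. Let $\delta_1\ge 0$ and $\delta_2\geq 0$ be integers and, for $i=1,2$, let $L_i(x_* )\in\mathbf{R}[x]_*$ be a functional that annuls $(f(x))^{\leq\delta_f+\delta_i}_x$. For a choice $\nabla f(x,y)$ of monotonous difference derivatives of $f_1,\ldots,f_n$ and a choice $\nabla_x(x,y)$ of a monotonous operator of difference derivative, set $$L(x_* )=L_1(x_* ).L_2(y_* ).\det\left\|\begin{matrix}\nabla f(x,y)&\nabla_x(x,y)\\ f(x)&\mathbf{1}_x(x)\end{matrix}\right\|=L_1(x_* ).L_2(y_* ).\det\left\|\begin{matrix}\nabla f(x,y)&\nabla_x(x,y)\\ f(y)&\mathbf{1}_x(y)\end{matrix}\right\|$$ (the two expressions are equal). Then: 1. $L(x_* )$ is uniquely determined in $\mathbf{R}[x^{\leq\delta_f+\delta_1+\delta_2+1}]$, independently of the choice of $\nabla f(x,y)$ and the choice of $\nabla_x(x,y)$; that is, any two such choices give functionals with the same values on $\mathbf{R}[x^{\leq\delta_f+\delta_1+\delta_2+1}]$. 2. $L(x_* )$ annuls $(f(x))^{\leq\delta_f+\delta_1+\delta_2+1}_x$. 3. $L(x_* )$ is uniquely determined in $\mathbf{R}[x^{\leq\delta_f+\delta_1+\delta_2+1}]$, independently of the determination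 of $L_1(x_* )$ outside $\mathbf{R}[x^{\leq\delta_f+\delta_1}]$ and of the determination of $L_2(x_* )$ outside $\mathbf{R}[x^{\leq\delta_f+\delta_2}]$; that is, replacing $L_1$, $L_2$ by functionals $L_1'$, $L_2'$ that coincide with $L_1$ on $\mathbf{R}[x^{\leq\delta_f+\delta_1}]$ and with $L_2$ on $\mathbf{R}[x^{\leq\delta_f+\delta_2}]$, respectively, does not change the values of $L(x_* )$ on $\mathbf{R}[x^{\leq\delta_f+\delta_1+\delta_2+1}]$.
   Context: Degrees: $\deg(F)$ is the total degree of a polynomial (maximal degree of a monomial with nonzero coefficient), in all the variables it involves (so in $(x,y)$ jointly for polynomials in $\mathbf{R}[x,y]$); $\deg(0)=-\infty$. $\mathbf{R}[x^{\leq d}]$ is the set of polynomials in $\mathbf{R}[x]$ of degree $\leq d$ (it is $\{0\}$ if $d<0$). Bounded ideal: for $f=(f_1,\ldots,f_s)$, $(f(x))^{\leq d}_x=\{\sum_{i=1}^s f_i(x)g^i(x)\mid g^i(x)\in\mathbf{R}[x],\ \deg(f_i)+\deg(g^i)\leq d \text{ for all } i\}$. Functionals: $\mathbf{R}[x]_*$ is the set of $\mathbf{R}$-linear maps $\mathbf{R}[x]\to\mathbf{R}$, written $l(x_* )$, with value on $F$ written $l(x_* ).F(x)$. A functional annuls a set if it vanishes on each of its elements. $l(y_* )$ denotes the same functional with the variables $x$ renamed $y$; on a polynomial in $\mathbf{R}[x,y]$ it acts on the $y$ variables, treating $x$ as coefficients (i.e. it is extended $\mathbf{R}[x]$-linearly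 to a map $\mathbf{R}[x][y]\to\mathbf{R}[x]$); similarly $l(x_* )$ acts on the $x$ variables. Difference derivatives: a difference derivative of $F(x)\in\mathbf{R}[x]$ is a tuple $\nabla F(x,y)=(\nabla^1F(x,y),\ldots,\nabla^nF(x,y))$ of polynomials in $\mathbf{R}[x,y]$ with $\sum_{k=1}^n(x_k-y_k)\nabla^kF(x,y)=F(x)-F(y)$. It is monotonous if every $\nabla^kF(x,y)$ has degree $\leq\deg(F)-1$ in $(x,y)$. An operator of difference derivative $\nabla_x(x,y)$ is an $\mathbf{R}$-linear map assigning to each $F(x)\in\mathbf{R}[x]$ a difference derivative $\nabla_x(x,y).F(x)=\nabla F(x,y)$ of $F$; it is monotonous if for every $F$ the degree of $\nabla_x(x,y).F(x)$ is $\leq\deg(F)-1$. Evaluation: $\mathbf{1}_x(x)$ and $\mathbf{1}_x(y)$ are the maps $F\mapsto F(x)$ and $F\mapsto F(y)$. Matrices: for $f=(f_1,\ldots,f_n)$, $\nabla f(x,y)$ is the $n\times n$ matrix with $(k,i)$ entry $\nabla^kf_i(x,y)$, where $\nabla f_i$ is a chosen difference derivative of $f_i$. The determinants are of $(n+1)\times(n+1)$ matrices whose first $n$ columns correspond to $f_1,\ldots,f_n$ and whose last row contains $f_1,\ldots,f_n$ in its first $n$ entries. The functional $L(x_* )=L_1(x_* ).L_2(y_* ).\det\|\cdots\|$ is the $\mathbf{R}$-linear map sending $F\in\mathbf{R}[x]$ to the value of $L_1(x_* ).L_2(y_* )$ on the determinant in which the last column is applied to $F$, i.e. is replaced by $(\nabla^1F(x,y),\ldots,\nabla^nF(x,y),F(x))^{\top}$,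 respectively $(\nabla^1F(x,y),\ldots,\nabla^nF(x,y),F(y))^{\top}$, where $\nabla F(x,y)=\nabla_x(x,y).F(x)$. *)

(* Defs.v *)
From HB Require Import structures.
From mathcomp Require Import all_boot all_order all_algebra.
From mathcomp Require Import ssrcomplements.
From mathcomp Require Export mpoly.

Set Implicit Arguments.
Unset Strict Implicit.
Unset Printing Implicit Defensive.

Import Order.TTheory GRing.Theory Num.Theory.
Local Open Scope ring_scope.

(* Degrees live in Z with -oo adjoined: [None] is -oo, the degree of 0. *)
Definition degree := option int.

Definition degree_add (a b : degree) : degree :=
  if a is Some i then if b is Some j then Some (i + j) else None else None.

Definition degree_le (a b : degree) : bool :=
  if a is Some i then if b is Some j then i <= j else false else true.

Definition total_degree (R : comNzRingType) (n : nat) (p : {mpoly R[n]}) :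
    degree :=
  if p == 0 then None else Some (msize p).-1%:Z.

(* The sum of the (deg (f i) - 1); it is -oo as soon as some f i is 0. *)
Definition delta (R : comNzRingType) (n : nat) (f : 'I_n -> {mpoly R[n]}) :
    degree :=
  \big[degree_add/Some 0]_(i < n) degree_add (total_degree (f i)) (Some (-1)).

Definition bounded_ideal (R : comNzRingType) (n : nat)
    (f : 'I_n -> {mpoly R[n]}) (d : degree) (p : {mpoly R[n]}) : Prop :=
  exists g : 'I_n -> {mpoly R[n]},
    (forall i, degree_le
       (degree_add (total_degree (f i)) (total_degree (g i))) d) /\
    p = \sum_(i < n) f i * g i.

Definition annuls (R : comNzRingType) (n : nat) (l : {scalar {mpoly R[n]}})
    (S : {mpoly R[n]} -> Prop) : Prop :=
  forall p, S p -> l p = 0.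

Definition agree_upto (R : comNzRingType) (n : nat) (d : degree)
    (l l' : {scalar {mpoly R[n]}}) : Prop :=
  forall p, degree_le (total_degree p) d -> l p = l' p.

(* R[x, y] is {mpoly R[n + n]}: the first n variables are the x_k, the last n
   ones are the y_k. *)
Definition varx (R : comNzRingType) (n : nat) (k : 'I_n) : {mpoly R[n + n]} :=
  'X_(lshift n k).

Definition vary (R : comNzRingType) (n : nat) (k : 'I_n) : {mpoly R[n + n]} :=
  'X_(rshift n k).

Definition in_x (R : comNzRingType) (n : nat) (p : {mpoly R[n]}) :
    {mpoly R[n + n]} := p \mPo [tuple varx R k | k < n].

Definition in_y (R : comNzRingType) (n : nat) (p : {mpoly R[n]}) :
    {mpoly R[n + n]} := p \mPo [tuple vary R k | k < n].

Definition mon_x (n : nat) (m : 'X_{1..n + n}) : 'X_{1..n} :=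
  [multinom m (lshift n k) | k < n].

Definition mon_y (n : nat) (m : 'X_{1..n + n}) : 'X_{1..n} :=
  [multinom m (rshift n k) | k < n].

(* l(y_* ) : R[x, y] -> R[x], the R[x]-linear extension of l: the monomial
   x^a y^b is sent to l(x^b) x^a (see apply_yM below). *)
Definition apply_y (R : comNzRingType) (n : nat) (l : {scalar {mpoly R[n]}})
    (G : {mpoly R[n + n]}) : {mpoly R[n]} :=
  \sum_(m <- msupp G) (G@_m * l 'X_[mon_y m]) *: 'X_[mon_x m].

Definition is_diff_derivative (R : comNzRingType) (n : nat) (F : {mpoly R[n]})
    (nF : {ffun 'I_n -> {mpoly R[n + n]}}) : Prop :=
  \sum_(k < n) (varx R k - vary R k) * nF k = in_x F - in_y F.

Definition monotonous (R : comNzRingType) (n : nat) (F : {mpoly R[n]})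
    (nF : {ffun 'I_n -> {mpoly R[n + n]}}) : Prop :=
  forall k, degree_le (total_degree (nF k))
                      (degree_add (total_degree F) (Some (-1))).

Definition monotonous_diff_derivatives (R : comNzRingType) (n : nat)
    (f : 'I_n -> {mpoly R[n]})
    (nf : 'I_n -> {ffun 'I_n -> {mpoly R[n + n]}}) : Prop :=
  forall i, is_diff_derivative (f i) (nf i) /\ monotonous (f i) (nf i).

Definition monotonous_diff_operator (R : comNzRingType) (n : nat)
    (D : {linear {mpoly R[n]} -> {ffun 'I_n -> {mpoly R[n + n]}}}) : Prop :=
  forall F, is_diff_derivative F (D F) /\ monotonous F (D F).

(* The bordered matrix with its last column applied to F; [ev] is the
   evaluation used in the last row, either F |-> F(x) or F |-> F(y). *)
Definition bordered (R : comNzRingType) (n : nat)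
    (ev : {linear {mpoly R[n]} -> {mpoly R[n + n]}}) (f : 'I_n -> {mpoly R[n]})
    (nf : 'I_n -> {ffun 'I_n -> {mpoly R[n + n]}})
    (D : {linear {mpoly R[n]} -> {ffun 'I_n -> {mpoly R[n + n]}}})
    (F : {mpoly R[n]}) : 'M[{mpoly R[n + n]}]_(n + 1) :=
  block_mx (\matrix_(k < n, i < n) nf i k) (\col_(k < n) D F k)
           (\row_(i < n) ev (f i))         (ev F)%:M.

Definition functional (R : comNzRingType) (n : nat)
    (ev : {linear {mpoly R[n]} -> {mpoly R[n + n]}}) (f : 'I_n -> {mpoly R[n]})
    (nf : 'I_n -> {ffun 'I_n -> {mpoly R[n + n]}})
    (D : {linear {mpoly R[n]} -> {ffun 'I_n -> {mpoly R[n + n]}}})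
    (L1 L2 : {scalar {mpoly R[n]}}) (F : {mpoly R[n]}) : R :=
  L1 (apply_y L2 (\det (bordered ev f nf D F))).

Section Linearity.
Variables (R : comNzRingType) (n : nat).

Lemma in_x_is_linear : linear (@in_x R n).
Proof. by move=> a p q; rewrite /in_x linearP. Qed.
HB.instance Definition _ :=
  GRing.isLinear.Build R {mpoly R[n]} {mpoly R[n + n]} *:%R (@in_x R n)
    in_x_is_linear.

Lemma in_y_is_linear : linear (@in_y R n).
Proof. by move=> a p q; rewrite /in_y linearP. Qed.
HB.instance Definition _ :=
  GRing.isLinear.Build R {mpoly R[n]} {mpoly R[n + n]} *:%R (@in_y R n)
    in_y_is_linear.

Lemma apply_yE (l : {scalar {mpoly R[n]}}) k (G : {mpoly R[n + n]}) :
  (msize G <= k)%N ->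
  apply_y l G =
  \sum_(m : 'X_{1..(n + n)%N < k}) (G@_m * l 'X_[mon_y m]) *: 'X_[mon_x m].
Proof.
move=> leGk; rewrite /apply_y; set I : subFinType _ := 'X_{1..(n + n)%N < k}.
rewrite (big_mksub I) //=; first last.
- by move=> m /msize_mdeg_lt /leq_trans; apply.
- by rewrite msupp_uniq.
by rewrite big_rmcond //= => m /memN_msupp_eq0 ->; rewrite mul0r scale0r.
Qed.

Lemma apply_y_is_linear (l : {scalar {mpoly R[n]}}) : linear (apply_y l).
Proof.
move=> a G H; set k := maxn (msize (a *: G + H)) (maxn (msize G) (msize H)).
rewrite (apply_yE l (k := k)) ?leq_maxl // [apply_y l G](apply_yE l (k := k));
  last by rewrite /k !leq_max leqnn !orbT.
rewrite [apply_y l H](apply_yE l (k := k)); last first.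
  by rewrite /k !leq_max leqnn !orbT.
rewrite scaler_sumr -big_split /=; apply: eq_bigr => m _.
by rewrite mcoeffD mcoeffZ mulrDl scalerDl scalerA mulrA.
Qed.

HB.instance Definition _ (l : {scalar {mpoly R[n]}}) :=
  GRing.isLinear.Build R {mpoly R[n + n]} {mpoly R[n]} *:%R (apply_y l)
    (apply_y_is_linear l).

Lemma apply_yM (l : {scalar {mpoly R[n]}}) (p q : {mpoly R[n]}) :
  apply_y l (in_x p * in_y q) = l q *: p.
Proof.
have apply_yX m : apply_y l 'X_[m] = l 'X_[mon_y m] *: 'X_[mon_x m].
  by rewrite /apply_y msuppX big_seq1 mcoeffX eqxx mul1r.
have lqE : l q = \sum_(m <- msupp q) q@_m * l 'X_[m].
  rewrite {1}[q]mpolyE raddf_sum /=; apply: eq_bigr => m _.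
  by rewrite linearZ.
rewrite [in_x p]comp_mpolyEX [in_y q]comp_mpolyEX mulr_suml raddf_sum /=.
rewrite {3}[p]mpolyE scaler_sumr; apply: eq_bigr => a _.
rewrite mulr_sumr raddf_sum /= lqE scaler_suml.
apply: eq_bigr => b _.
rewrite -scalerAl -scalerAr !linearZ /= !comp_mpolyX.
under eq_bigr do rewrite tnth_mktuple.
under [X in _ * X]eq_bigr do rewrite tnth_mktuple.
have -> : \prod_(i < n) varx R i ^+ a i * \prod_(i < n) vary R i ^+ b i =
  'X_[[multinom (match split i with inl j => a j | inr j => b j end)
        | i < n + n]].
  rewrite mpolyXE_id big_split_ord /=; congr (_ * _); apply: eq_bigr => i _.
    by rewrite mnmE (unsplitK (inl i)).
  by rewrite mnmE (unsplitK (inr i)).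
rewrite apply_yX.
have -> : mon_x [multinom (match split i with inl j => a j | inr j => b j end)
        | i < n + n] = a.
  by apply/mnmP=> i; rewrite !mnmE (unsplitK (inl i)).
have -> : mon_y [multinom (match split i with inl j => a j | inr j => b j end)
        | i < n + n] = b.
  by apply/mnmP=> i; rewrite !mnmE (unsplitK (inr i)).
by rewrite !scalerA mulrA.
Qed.

Variables (ev : {linear {mpoly R[n]} -> {mpoly R[n + n]}}).
Variables (f : 'I_n -> {mpoly R[n]}).
Variables (nf : 'I_n -> {ffun 'I_n -> {mpoly R[n + n]}}).
Variables (D : {linear {mpoly R[n]} -> {ffun 'I_n -> {mpoly R[n + n]}}}).

Lemma det_bordered_is_linear : linear (fun F => \det (bordered ev f nf D F)).
Proof.
move=> a F G; pose c : 'I_(n + 1) := rshift n ord0.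
have colE i H : bordered ev f nf D H i c =
    if split i is inl k then D H k else ev H.
  rewrite /bordered; case: (split_ordP i) => k ->.
    by rewrite block_mxEur mxE.
  by rewrite block_mxEdr mxE !ord1 eqxx mulr1n.
have cofE i H : cofactor (bordered ev f nf D H) i c =
    cofactor (bordered ev f nf D 0) i c.
  congr (_ * \det _); apply/matrixP => k j; rewrite 2!mxE [RHS]mxE [RHS]mxE.
  case: (split_ordP (lift c j)) => j' ej.
    by rewrite ej /bordered; case: (split_ordP (lift i k)) => k' ->;
      rewrite ?block_mxEul ?block_mxEdl !mxE.
  by have /eqP[] := neq_lift c j; rewrite ej /c !ord1.
rewrite !(expand_det_col _ c) scaler_sumr -big_split /=.
apply: eq_bigr => i _; rewrite !cofE !colE scalerAl -mulrDl.
by congr (_ * _); case: split => k; rewrite linearP ?ffunE.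
Qed.

Variables (L1 L2 : {scalar {mpoly R[n]}}).

Lemma functional_is_scalar : scalar (functional ev f nf D L1 L2).
Proof.
by move=> a F G; rewrite /functional det_bordered_is_linear !linearP.
Qed.
HB.instance Definition _ :=
  GRing.isLinear.Build R {mpoly R[n]} R *%R (functional ev f nf D L1 L2)
    functional_is_scalar.

End Linearity.

(* Main.v *)
Require Import Defs.
From HB Require Import structures.
From mathcomp Require Import all_boot all_order all_algebra.
From mathcomp Require Import perm mpoly.
From mathcomp Require Import zify ring.

Set Implicit Arguments.
Unset Strict Implicit.
Unset Printing Implicit Defensive.

Import Order.TTheory GRing.Theory Num.Theory.
Local Open Scope ring_scope.

(** The determinant is a sum of products of polynomials in x and y, and
    [L1 (x) . L2 (y)] kills a product p(x) q(y) C(x, y) as soon as, for every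
    monomial x^a y^b of C, either L1 kills p x^a or L2 kills q y^b
    ([apply_xy_product]).  The hypotheses on L1 and L2 give this for
    p = f_i and q = f_j whenever
    |a| + |b| + deg f_i + deg f_j <= 2 delta_f + d1 + d2 + 1:
    if |a| + deg f_i exceeds delta_f + d1, then |b| + deg f_j is at most
    delta_f + d2.  So everything reduces to bringing two of the f's, one in x
    and one in y, into the rows of a determinant, and to counting degrees.

    The tool is the relation between rows: with u_k = x_k - y_k, the
    combination of the rows of difference derivatives with coefficients u_k is
    f(x) - f(y) (and F(x) - F(y) in the last column).  It gives at once the
    equality of the two determinants.

    Independence of the difference derivatives: columns may be changed one at
    a time, and by linearity of the determinant one must kill a determinant
    with a column (h, 0) such that sum_k u_k h_k = 0.  The u_k form a regular
    sequence, so h is a combination of the Koszul syzygies u_k e_l - u_l e_k,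
    with coefficients of degree one less than h ([diffxy_syzygy]).  For a
    Koszul syzygy, multiplying row k by u_k and using the row relation turns
    that row into the values in y; since u_k is regular the determinant is, up
    to sign, one whose rows include both the values in x and the values in y
    ([det_border_koszul]), and which is therefore killed.

    Annihilation of f_i g: independence allows the difference derivative
    (nabla f_i) g(x) + f_i(y) nabla g.  Subtracting g(x) times the column of
    f_i from the last one leaves the column (f_i(y) nabla g, 0); the factor
    f_i(y) comes out, and the last row still holds f(x)
    ([bordered_multiple]).

    Independence of the values of L1 and L2 in high degrees: by bilinearity
    one of the two functionals may be assumed to vanish in low degrees, and
    then a single row of f's, in the variables of the other functional, is
    enough ([bordered_vanish_l], [bordered_vanish_r]). *)

(** * Degree bounds *)

Section DegreeBounds.
Variables (R : comNzRingType) (N : nat).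
Implicit Types (p q : {mpoly R[N]}) (d e : int).

(** The bound is an integer, possibly negative (and then p = 0): bounds thus
    add up under products without any side condition on zero factors, and the
    derivatives of constants have a bound too. *)
Definition deg_le d p : Prop := forall m, m \in msupp p -> (mdeg m)%:Z <= d.

Lemma deg_leW d e p : d <= e -> deg_le d p -> deg_le e p.
Proof. by move=> de dp m /dp md; apply: le_trans de. Qed.

Lemma deg_le0 d : deg_le d (0 : {mpoly R[N]}).
Proof. by move=> m; rewrite msupp0. Qed.

Lemma deg_leD d p q : deg_le d p -> deg_le d q -> deg_le d (p + q).
Proof.
by move=> dp dq m /msuppD_le; rewrite mem_cat => /orP[/dp|/dq].
Qed.

Lemma deg_leN d p : deg_le d p -> deg_le d (- p).
Proof. by move=> dp m; rewrite (perm_mem (msuppN p)) => /dp. Qed.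

Lemma deg_leB d p q : deg_le d p -> deg_le d q -> deg_le d (p - q).
Proof. by move=> dp dq; apply/deg_leD/deg_leN. Qed.

Lemma deg_leZ d c p : deg_le d p -> deg_le d (c *: p).
Proof. by move=> dp m /msuppZ_le /dp. Qed.

Lemma deg_leX m : deg_le (mdeg m)%:Z ('X_[m] : {mpoly R[N]}).
Proof. by move=> m'; rewrite msuppX mem_seq1 => /eqP ->. Qed.

Lemma deg_le1 : deg_le 0 (1 : {mpoly R[N]}).
Proof. by rewrite -mpolyX0; have := @deg_leX 0%MM; rewrite mdeg0. Qed.

Lemma deg_leM d e p q : deg_le d p -> deg_le e q -> deg_le (d + e) (p * q).
Proof.
move=> dp eq m /msuppM_le /allpairsP[[m1 m2] /= [/dp h1 /eq h2 ->]].
by rewrite mdegD PoszD lerD.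
Qed.

Lemma deg_le_prod (I : finType) (P : pred I) (e : I -> int)
    (F : I -> {mpoly R[N]}) :
  (forall i, P i -> deg_le (e i) (F i)) ->
  deg_le (\sum_(i | P i) e i) (\prod_(i | P i) F i).
Proof.
by move=> dF; elim/big_rec2: _ => [|i d p Pi dp];
  [exact: deg_le1 | apply: deg_leM (dF i Pi) dp].
Qed.

Lemma deg_leP d p : degree_le (total_degree p) (Some d) <-> deg_le d p.
Proof.
rewrite /total_degree; have [->|nz_p] := eqVneq p 0.
  by split=> // _; apply: deg_le0.
have dE := mlead_deg nz_p; rewrite -dE /=; split=> [le_d m|dp]; last first.
  exact/dp/mlead_supp.
move=> /msize_mdeg_lt; rewrite -dE ltnS => le_m.
by apply: le_trans le_d; rewrite lez_nat.
Qed.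

Lemma total_degreeX m : total_degree ('X_[m] : {mpoly R[N]}) = Some (mdeg m)%:Z.
Proof. by rewrite /total_degree -msize_poly_eq0 msizeX. Qed.

End DegreeBounds.

(** * Syzygies of the differences x_k - y_k *)

Section DiagonalSyzygies.
Variables (R : comNzRingType) (n : nat).
Local Notation A := {mpoly R[n + n]}.

Definition diffxy k : A := varx R k - vary R k.

(** Whichever of x_k and y_k leads, the leading coefficient is 1 or -1, so that
    this holds over rings with zero divisors. *)
Lemma lreg_diffxy k : GRing.lreg (diffxy k).
Proof.
apply: lreg_mleadc; set u := diffxy k.
have uE m : u@_m = (U_(lshift n k) == m)%MM%:R - (U_(rshift n k) == m)%MM%:R.
  by rewrite mcoeffB !mcoeffX.
have nxy : (U_(lshift n k) == U_(rshift n k))%MM = false.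
  by apply/eqP => /mnmP/(_ (lshift n k)); rewrite !mnmE eqxx eq_rlshift.
have nz_u : u != 0.
  apply/eqP => /(congr1 (mcoeff U_(lshift n k))).
  rewrite uE eqxx [_ == U_(lshift n k)%MM]eq_sym nxy subr0 mcoeff0.
  by apply/eqP/oner_neq0.
have := mlead_supp nz_u; rewrite mcoeff_msupp uE.
have [<-|_] := eqVneq U_(lshift n k)%MM (mlead u).
  by rewrite [U_(rshift n k)%MM == _]eq_sym nxy subr0 => _; apply: lreg1.
have [_|_] := eqVneq U_(rshift n k)%MM (mlead u); last by rewrite subr0 eqxx.
by rewrite sub0r => _; apply/lregN/lreg1.
Qed.

(** The substitution x_k := y_k, with the other variables unchanged: the
    projection modulo x_k - y_k. *)
Definition glue k : A -> A :=
  comp_mpoly [tuple if i == lshift n k then vary R k else 'X_i | i < n + n].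
HB.instance Definition _ k := GRing.RMorphism.on (glue k).

Lemma glueX k i :
  glue k 'X_i = if i == lshift n k then vary R k else 'X_i.
Proof. by rewrite /glue comp_mpolyXU -tnth_nth tnth_mktuple. Qed.

Lemma glue_diffxy k l : glue k (diffxy l) = if l == k then 0 else diffxy l.
Proof.
rewrite rmorphB /= !glueX eq_rlshift (inj_eq (@lshift_inj _ _)).
by case: eqP => // ->; rewrite subrr.
Qed.

(** Division by x_k - y_k with control of the degree.  The pairs (p, d) that
    satisfy the conclusion are stable under products and linear combinations,
    so that it suffices to treat the variables. *)
Lemma glue_div k (d : int) (p : A) : deg_le d p ->
  exists q, [/\ p = glue k p + diffxy k * q, deg_le (d - 1) q
              & deg_le d (glue k p)].
Proof.
pose ok (e : int) (p : A) := exists q,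
  [/\ p = glue k p + diffxy k * q, deg_le (e - 1) q & deg_le e (glue k p)].
rewrite -[exists q, _]/(ok d p).
have ok0 e : ok e 0.
  by exists 0; rewrite rmorph0 mulr0 addr0; split=> //; apply: deg_le0.
have okD e p1 p2 : ok e p1 -> ok e p2 -> ok e (p1 + p2).
  move=> [q1 [E1 d1 g1]] [q2 [E2 d2 g2]]; exists (q1 + q2).
  split; rewrite ?rmorphD; try by apply: deg_leD.
  by rewrite {1}E1 {1}E2 mulrDr addrACA.
have okZ e c p1 : ok e p1 -> ok e (c *: p1).
  move=> [q1 [E1 d1 g1]]; exists (c *: q1); rewrite /glue linearZ /= -/(glue _).
  split; try by apply: deg_leZ.
  by rewrite {1}E1 scalerDr scalerAr.
have ok1 : ok 0 1.
  by exists 0; rewrite rmorph1 mulr0 addr0; split=> //;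
    [apply: deg_le0 | apply: deg_le1].
have okM e1 e2 p1 p2 : ok e1 p1 -> ok e2 p2 -> deg_le e2 p2 ->
    ok (e1 + e2) (p1 * p2).
  move=> [q1 [E1 d1 g1]] [q2 [E2 d2 g2]] dp2.
  exists (q1 * p2 + glue k p1 * q2); split.
  - by rewrite rmorphM {1}E1 mulrDl {1}E2; ring.
  - apply: deg_leD; first by rewrite addrAC; apply: deg_leM.
    by rewrite -addrA; apply: deg_leM.
  - by rewrite rmorphM; apply: deg_leM.
have okX i : ok 1 'X_i.
  have d1 j : deg_le 1 ('X_j : A).
    by have := @deg_leX R _ U_(j)%MM; rewrite mdeg1.
  rewrite /ok glueX subrr; case: eqP => [->|_]; last first.
    by exists 0; rewrite mulr0 addr0; split=> //; apply: deg_le0.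
  exists 1; split; [by rewrite mulr1 addrC subrK | exact: deg_le1 | exact: d1].
have okm m : ok (mdeg m)%:Z 'X_[m] /\ deg_le (mdeg m)%:Z ('X_[m] : A).
  split; last exact: deg_leX.
  have okXn i a : ok a%:Z ('X_i ^+ a) /\ deg_le a%:Z ('X_i ^+ a : A).
    have dXn b : deg_le b%:Z ('X_i ^+ b : A).
      have := @deg_leX R _ (U_(i) *+ b)%MM.
      by rewrite mdegMn mdeg1 mul1n mpolyXn.
    split=> //; elim: a => [|a IHa]; first by rewrite expr0.
    by rewrite exprS -addn1 addnC PoszD; apply: okM.
  suff: ok (mdeg m)%:Z 'X_[m] /\ deg_le (mdeg m)%:Z ('X_[m] : A) by case.
  rewrite mpolyXE_id mdegE.
  elim/big_rec2: _ => [|i p1 e _ [okp dp1]].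
    by split=> //; apply: deg_le1.
  have [okXi dXi] := okXn i (m i); rewrite PoszD.
  by split; [apply: okM | apply: deg_leM].
move=> dp; rewrite [p]mpolyE big_seq.
apply: (big_ind (ok d)) => [||m /dp le_m]; [exact: ok0 | exact: okD |].
apply: okZ; have [q [E dq g]] := (okm m).1.
by exists q; split=> //; [apply: deg_leW dq; rewrite lerD2r | apply: deg_leW g].
Qed.

(** The degree one part of the exactness of the Koszul complex of the x_k - y_k,
    with a bound on the degree.  The induction is on the number t of indices
    that h may involve.  For the last of them, j, write
    h_k = h_k|_(x_j = y_j) + u_j q_k.  Putting x_j = y_j in the relation shows
    that the h_k|_(x_j = y_j), k <> j, form a syzygy; subtracting it, and
    cancelling u_j, gives h_j = - sum_(k <> j) u_k q_k.  So h differs from a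
    syzygy without j-th component by sum_k q_k (u_j e_k - u_k e_j). *)
Lemma diffxy_syzygy (d : int) (h : 'I_n -> A) :
  \sum_k diffxy k * h k = 0 -> (forall k, deg_le d (h k)) ->
  exists2 a : 'I_n -> 'I_n -> A, forall k l, deg_le (d - 1) (a k l)
    & forall m, h m = \sum_k diffxy k * (a k m - a m k).
Proof.
have [t le_nt] := ubnP n; move: le_nt => /ltnW le_nt.
have: forall k : 'I_n, (t <= k)%N -> h k = 0.
  by move=> k /(leq_trans le_nt); rewrite leqNgt ltn_ord.
elim: t {le_nt} h => [|t IHt] h h0 uh0 dh.
  exists (fun _ _ => 0) => [k l|m]; first exact: deg_le0.
  by rewrite h0 // big1 // => k _; rewrite subrr mulr0.
have [lt_tn|le_nt] := ltnP t n; last first.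
  by apply: IHt => // k /(leq_trans le_nt); rewrite leqNgt ltn_ord.
pose j := Ordinal lt_tn.
have [q qP] : exists q : {ffun 'I_n -> A}, forall k,
    [/\ h k = glue j (h k) + diffxy j * q k, deg_le (d - 1) (q k)
      & deg_le d (glue j (h k))].
  have [q qP] := fin_all_exists (fun k => glue_div j (dh k)).
  by exists [ffun k => q k] => k; rewrite ffunE.
have gh0 : \sum_(k | k != j) diffxy k * glue j (h k) = 0.
  have := congr1 (glue j) uh0; rewrite rmorph0 rmorph_sum (bigD1 j) //=.
  rewrite rmorphM /= glue_diffxy eqxx mul0r add0r => g0.
  rewrite -[RHS]g0; apply: eq_bigr => k nkj.
  by rewrite rmorphM /= glue_diffxy (negPf nkj).
have hj : h j = - \sum_(k | k != j) diffxy k * q k.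
  apply/eqP; rewrite -addr_eq0; apply/eqP; apply: (@lreg_diffxy j).
  rewrite mulr0 mulrDr mulr_sumr -[RHS]uh0 [RHS](bigD1 j) //=; congr (_ + _).
  rewrite -[LHS]add0r -[X in X + _]gh0 -big_split; apply: eq_bigr => k _ /=.
  by case: (qP k) => hk _ _; rewrite [in RHS]hk mulrDr mulrCA.
pose h' k := if k == j then 0 else glue j (h k).
have [k le_tk|||a da aP] := IHt h'.
- rewrite /h'; case: eqP => // /eqP nkj.
  rewrite h0 ?rmorph0 // ltn_neqAle le_tk andbT.
  by apply: contra_neq nkj => tk; apply/val_inj.
- rewrite (bigD1 j) //= {1}/h' eqxx mulr0 add0r -[RHS]gh0.
  by apply: eq_bigr => k nkj; rewrite /h' (negPf nkj).
- by move=> k; rewrite /h'; case: eqP => _; [apply: deg_le0 | case: (qP k)].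
exists (fun k l => a k l + if (k == j) && (l != j) then q l else 0).
  move=> k l; apply: deg_leD => //; case: ifP => _; last exact: deg_le0.
  by case: (qP l).
move=> m; under eq_bigr do rewrite opprD addrACA mulrDr.
rewrite big_split /= -aP /h'; have [->|nmj] := eqVneq m j.
  rewrite add0r hj big_mkcond -sumrN; apply: eq_bigr => k _.
  rewrite ?eqxx andbF /= sub0r mulrN.
  by have [_|_] := eqVneq k j; rewrite ?mulr0 ?oppr0.
rewrite (bigD1 j) //= eqxx subr0 big1 ?addr0; first by case: (qP m).
by move=> k nkj; rewrite (negPf nkj) subr0 mulr0.
Qed.

End DiagonalSyzygies.

(** * Determinants with a modified row or column *)

Section Determinants.
Variables (A : comNzRingType) (N : nat).
Implicit Types (M B : 'M[A]_N).

Lemma det_row_comb M B r (w : 'I_N -> A) :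
    (forall i j, i != r -> B i j = M i j) ->
    (forall j, B r j = \sum_k w k * M k j) ->
  \det B = w r * \det M.
Proof.
move=> BM Br; rewrite (expand_det_row _ r).
have cofE j : cofactor B r j = \adj M j r.
  rewrite mxE; congr (_ * \det _); apply/matrixP => i k; rewrite !mxE BM //.
  by rewrite eq_sym neq_lift.
have adjE k : \sum_j w k * M k j * \adj M j r = (w k * \det M) *+ (k == r).
  under eq_bigr do rewrite -mulrA.
  rewrite -mulr_sumr -mulrnAr; congr (_ * _).
  by have /matrixP/(_ k r) := mul_mx_adj M; rewrite !mxE.
under eq_bigr do rewrite Br cofE mulr_suml.
rewrite exchange_big /= (eq_bigr _ (fun k _ => adjE k)) (bigD1 r) //= eqxx.
by rewrite big1 ?addr0 // => k /negPf ->.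
Qed.

Lemma det_col_comb M B c (w : 'I_N -> A) :
    (forall i j, j != c -> B i j = M i j) ->
    (forall i, B i c = \sum_k w k * M i k) ->
  \det B = w c * \det M.
Proof.
move=> BM Bc; rewrite -det_tr -[\det M]det_tr.
apply: det_row_comb => [i j nic|j]; rewrite !mxE; first exact: BM.
by rewrite Bc; apply: eq_bigr => k _; rewrite mxE.
Qed.

Lemma det_row_scale M B r (w : A) :
    (forall i j, i != r -> B i j = M i j) -> (forall j, B r j = w * M r j) ->
  \det B = w * \det M.
Proof.
move=> BM Br; rewrite (det_row_comb (w := fun k => (k == r)%:R * w) BM) => [|j].
  by rewrite eqxx mul1r.
rewrite Br (bigD1 r) //= eqxx mul1r big1 ?addr0 // => k nkr.
by rewrite (negPf nkr) !mul0r.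
Qed.

Lemma det_col_scale M B c (w : A) :
    (forall i j, j != c -> B i j = M i j) -> (forall i, B i c = w * M i c) ->
  \det B = w * \det M.
Proof.
move=> BM Bc; rewrite -det_tr -[\det M]det_tr.
by apply: (@det_row_scale _ _ c) => [i j nic|j]; rewrite !mxE; [exact: BM|].
Qed.

Lemma det_col_sum (I : finType) (M : I -> 'M[A]_N) B c :
    (forall k i j, j != c -> M k i j = B i j) ->
    (forall i, B i c = \sum_k M k i c) ->
  \det B = \sum_k \det (M k).
Proof.
move=> MB Bc; rewrite (expand_det_col B c).
under [RHS]eq_bigr => k _ do rewrite (expand_det_col _ c).
rewrite exchange_big /=; apply: eq_bigr => i _; rewrite Bc mulr_suml.
apply: eq_bigr => k _; congr (_ * (_ * \det _)).
by apply/matrixP => i' j; rewrite !mxE MB // eq_sym neq_lift.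
Qed.

End Determinants.

(** * Bordered determinants *)

Section Border.
Variables (A : comNzRingType) (n : nat).

(** V lists the columns without their last entries, which are given by Z; all
    n + 1 columns are treated alike, as the column of F plays the same part as
    those of the f_i in the changes of difference derivatives. *)
Definition border (V : 'I_(n + 1) -> 'I_n -> A) (Z : 'I_(n + 1) -> A) :
    'M[A]_(n + 1) :=
  \matrix_(r, c) match split r with inl k => V c k | inr _ => Z c end.

Lemma border_top V Z k c : border V Z (lshift 1 k) c = V c k.
Proof. by rewrite mxE (unsplitK (inl k)). Qed.

Lemma border_bot V Z c : border V Z (rshift n ord0) c = Z c.
Proof. by rewrite mxE (unsplitK (inr ord0)). Qed.

(** The row X is the row Y plus a combination of the other rows. *)
Lemma det_border_diff (u : 'I_n -> A) V X Y :
    (forall c, \sum_k u k * V c k = X c - Y c) ->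
  \det (border V X) = \det (border V Y).
Proof.
move=> VXY; rewrite -[RHS]mul1r.
pose w (r : 'I_(n + 1)) := if split r is inl k then u k else 1.
have -> : 1 = w (rshift n ord0) by rewrite /w (unsplitK (inr ord0)).
apply: det_row_comb => [i c|c].
  by case: (split_ordP i) => k ->; rewrite ?border_top // ord1 eqxx.
rewrite big_split_ord big_ord1 /= !border_bot /w (unsplitK (inr ord0)) mul1r.
under eq_bigr do rewrite border_top (unsplitK (inl _)).
by rewrite VXY subrK.
Qed.

(** Column c0 is a times the Koszul syzygy u_k e_l - u_l e_k.  Multiply row k by
    u_k, add u_j times each other row j and subtract the last row: row k becomes
    - Y, and 0 in column c0 since the syzygy is annihilated by u.  Only the entry
    a u_k in row l remains in that column; the factor u_k then cancels. *)
Lemma det_border_koszul (u : 'I_n -> A) V X Y c0 k l a :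
    k != l -> GRing.lreg (u k) ->
    (forall c, c != c0 -> \sum_j u j * V c j = X c - Y c) ->
    (forall m, V c0 m = a * (u k * (m == l)%:R - u l * (m == k)%:R)) ->
    X c0 = 0 ->
  \det (border V X) = - \det (\matrix_(r, c)
    if c == c0 then (r == lshift 1 l)%:R * a
    else if r == lshift 1 k then Y c else border V X r c).
Proof.
move=> nkl reg_u VXY V0 X0; set M := \matrix_(r, c) _.
apply: reg_u.
pose w (r : 'I_(n + 1)) := if split r is inl j then u j else - 1.
(* Row k after the row operations, the others being unchanged. *)
pose M1 : 'M[A]_(n + 1) := \matrix_(r, c)
  if r == lshift 1 k then \sum_i w i * border V X i c else border V X r c.
have M1k c : M1 (lshift 1 k) c = if c == c0 then 0 else - Y c.
  rewrite mxE eqxx big_split_ord big_ord1 /= border_bot /w (unsplitK (inr ord0)).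
  under eq_bigr do rewrite border_top (unsplitK (inl _)).
  have [->|nc] := eqVneq c c0; last by rewrite VXY // mulN1r addrC addKr.
  rewrite X0 mulr0 addr0; under eq_bigr do rewrite V0 mulrCA mulrBr.
  rewrite -mulr_sumr sumrB (bigD1 l) //= [X in _ - X](bigD1 k) //= !eqxx !mulr1.
  rewrite ![\sum_(i < n | _) _]big1 => [|j /negPf->|j /negPf->];
    rewrite ?mulr0 //.
  by rewrite !addr0 [u k * u l]mulrC subrr mulr0.
have -> : u k * \det (border V X) = \det M1.
  have -> : u k = w (lshift 1 k) by rewrite /w (unsplitK (inl k)).
  by apply/esym/det_row_comb => [i j nik|j]; rewrite mxE ?eqxx // (negPf nik).
(* The factor u k of column c0 taken out. *)
pose M2 : 'M[A]_(n + 1) := \matrix_(r, c)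
  if c == c0 then (r == lshift 1 l)%:R * a else M1 r c.
rewrite (@det_col_scale _ _ M2 _ c0 (u k)).
- rewrite -[- _]mulN1r; congr (_ * _).
  apply: (@det_row_scale _ _ _ _ (lshift 1 k)).
    by move=> i c nik; rewrite !mxE (negPf nik).
  move=> c; rewrite mxE M1k [M _ _]mxE !eqxx.
  by case: eqP => _; rewrite ?mulN1r // eq_lshift (negPf nkl) !mul0r oppr0.
- by move=> i j njc; rewrite [RHS]mxE (negPf njc).
move=> i; rewrite [M2 _ _]mxE eqxx.
have [->|nik] := eqVneq i (lshift 1 k).
  by rewrite M1k eqxx eq_lshift (negPf nkl) mul0r mulr0.
rewrite mxE (negPf nik); case: (split_ordP i) nik => j -> nik; last first.
  by rewrite ord1 border_bot X0 eq_rlshift mul0r mulr0.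
rewrite eq_lshift in nik; rewrite border_top V0 !eq_lshift (negPf nik).
by rewrite mulr0 subr0; ring.
Qed.

End Border.

(** * Products and determinants killed by L1 (x) . L2 (y) *)

Section Annihilation.
Variables (R : comNzRingType) (n : nat) (L1 L2 : {scalar {mpoly R[n]}}).
Local Notation A := {mpoly R[n + n]}.

Definition apply_xy (G : A) : R := L1 (apply_y L2 G).

Lemma apply_xy_is_scalar : scalar apply_xy.
Proof. by move=> a F G; rewrite /apply_xy !linearP. Qed.
HB.instance Definition _ :=
  GRing.isLinear.Build R A R *%R apply_xy apply_xy_is_scalar.

Lemma in_xM (p q : {mpoly R[n]}) : in_x (p * q) = in_x p * in_x q.
Proof. by rewrite /in_x rmorphM. Qed.

Lemma in_yM (p q : {mpoly R[n]}) : in_y (p * q) = in_y p * in_y q.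
Proof. by rewrite /in_y rmorphM. Qed.

Lemma mpolyX_xy m :
  'X_[m] = in_x 'X_[mon_x m] * in_y 'X_[mon_y m] :> A.
Proof.
rewrite mpolyXE_id big_split_ord /= /in_x /in_y !comp_mpolyX.
by congr (_ * _); apply: eq_bigr => i _; rewrite tnth_mktuple mnmE.
Qed.

Lemma mdeg_xy (m : 'X_{1..n + n}) :
  mdeg m = (mdeg (mon_x m) + mdeg (mon_y m))%N.
Proof.
rewrite !mdegE big_split_ord /=.
by congr (_ + _)%N; apply: eq_bigr => i _; rewrite mnmE.
Qed.

Definition annul_products d p q := forall a b : 'X_{1..n},
  (mdeg a + mdeg b)%:Z <= d -> L1 (p * 'X_[a]) = 0 \/ L2 (q * 'X_[b]) = 0.

Lemma apply_xy_product d p q G :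
    annul_products d p q -> deg_le d G ->
  apply_xy (in_x p * in_y q * G) = 0.
Proof.
move=> kill dG; rewrite [G]mpolyE mulr_sumr raddf_sum big_seq big1 //= => m mG.
rewrite -scalerAr linearZ /= mpolyX_xy mulrACA -in_xM -in_yM /apply_xy apply_yM.
rewrite linearZ /=; have [|->|->] := kill (mon_x m) (mon_y m).
- by rewrite -mdeg_xy; apply: dG.
- by rewrite !mulr0.
- by rewrite mul0r mulr0.
Qed.

Lemma apply_xy_det N (M : 'M[A]_N) :
  (forall s : 'S_N, apply_xy (\prod_r M r (s r)) = 0) -> apply_xy (\det M) = 0.
Proof.
move=> kill; rewrite raddf_sum big1 //= => s _.
by rewrite -signr_odd mulr_sign; case: ifP => _; rewrite ?raddfN /= kill ?oppr0.
Qed.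

(** In each Leibniz term the row r0 contributes p_c(x) q_c(y), and the other rows
    an entry of each of the remaining columns: their product has degree at most
    the sum of the column bounds other than D c. *)
Lemma apply_xy_det_row N (M : 'M[A]_N) r0 (D : 'I_N -> int) p q :
    (forall c, M r0 c = in_x (p c) * in_y (q c)) ->
    (forall r c, r != r0 -> deg_le (D c) (M r c)) ->
    (forall c, annul_products (\sum_i D i - D c) (p c) (q c)) ->
  apply_xy (\det M) = 0.
Proof.
move=> M0 dM kill; apply: apply_xy_det => s; rewrite (bigD1 r0) //= M0.
apply: apply_xy_product (kill _) _.
rewrite (reindex_inj (@perm_inj _ s)) (bigD1 r0) //= addrAC subrr add0r.
by apply: deg_le_prod => r nr; apply: dM.
Qed.

Lemma apply_xy_det_rows N (M : 'M[A]_N) r1 r2 (D : 'I_N -> int) p q :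
    r1 != r2 ->
    (forall c, M r1 c = in_x (p c)) -> (forall c, M r2 c = in_y (q c)) ->
    (forall r c, r != r1 -> r != r2 -> deg_le (D c) (M r c)) ->
    (forall c1 c2, c1 != c2 ->
       annul_products (\sum_i D i - D c1 - D c2) (p c1) (q c2)) ->
  apply_xy (\det M) = 0.
Proof.
move=> n12 M1 M2 dM kill; apply: apply_xy_det => s.
have n21 : r2 != r1 by rewrite eq_sym.
rewrite (bigD1 r1) //= (bigD1 r2) //= M1 M2 mulrA.
have /kill ks : s r1 != s r2 by rewrite (inj_eq perm_inj).
apply: apply_xy_product ks _.
rewrite (reindex_inj (@perm_inj _ s)) (bigD1 r1) //= (bigD1 r2) //=.
rewrite [_ + _ - D (s r1)]addrAC subrr add0r [_ + _ - _]addrAC subrr add0r.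
by apply: deg_le_prod => r /andP[nr1 nr2]; apply: dM.
Qed.

End Annihilation.

(** * Independence of the difference derivatives *)

Section Independence.
Variables (R : comNzRingType) (n : nat) (L1 L2 : {scalar {mpoly R[n]}}).
Local Notation A := {mpoly R[n + n]}.
Variables (phi : 'I_(n + 1) -> {mpoly R[n]}) (E : 'I_(n + 1) -> int).

(** Columns are plain functions, as the proofs replace single entries. *)
Definition quotients (F : {mpoly R[n]}) (v : 'I_n -> A) : Prop :=
  \sum_k diffxy R k * v k = in_x F - in_y F.

Definition deg_quotients d (F : {mpoly R[n]}) (v : 'I_n -> A) : Prop :=
  quotients F v /\ forall k, deg_le d (v k).

(* The -1 is the degree lost in passing from a syzygy to its coefficients. *)
Hypothesis kill : forall c1 c2, c1 != c2 ->
  annul_products L1 L2 (\sum_i E i - 1 - E c1 - E c2) (phi c1) (phi c2).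

(** Expressing column c0 by Koszul syzygies leaves determinants with a row of
    values in x and a row of values in y; column c0 then has degree one less
    than E c0. *)
Lemma apply_xy_border_syzygy c0 V :
    (forall c, c != c0 -> quotients (phi c) (V c)) ->
    \sum_k diffxy R k * V c0 k = 0 ->
    (forall c k, deg_le (E c) (V c k)) ->
  apply_xy L1 L2
    (\det (border V (fun c => if c == c0 then 0 else in_x (phi c)))) = 0.
Proof.
move=> VE V0 dV; pose phi0 c : {mpoly R[n]} := if c == c0 then 0 else phi c.
have [a da aE] := diffxy_syzygy V0 (dV c0).
pose v (kl : 'I_n * 'I_n) (m : 'I_n) : A := a kl.1 kl.2 *
  (diffxy R kl.1 * (m == kl.2)%:R - diffxy R kl.2 * (m == kl.1)%:R).
pose W kl c m : A := if c == c0 then v kl m else V c m.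
rewrite (det_col_sum (M := fun kl => border (W kl)
  (fun c => if c == c0 then 0 else in_x (phi c))) (c := c0)); first last.
- move=> r; case: (split_ordP r) => m ->; last first.
    by rewrite ord1 border_bot eqxx big1 // => kl _; rewrite border_bot eqxx.
  rewrite border_top aE.
  transitivity (\sum_k \sum_l a k l *
      (diffxy R k * (m == l)%:R - diffxy R l * (m == k)%:R)); last first.
    by rewrite pair_bigA; apply: eq_bigr => kl _; rewrite border_top /W eqxx.
  under eq_bigr do rewrite mulrBr; rewrite sumrB.
  under [RHS]eq_bigr => k _ do under eq_bigr do rewrite mulrBr.
  under [RHS]eq_bigr => k _ do rewrite sumrB.
  rewrite sumrB; congr (_ - _).
    apply: eq_bigr => k _; rewrite (bigD1 m) //= eqxx mulr1 mulrC.
    rewrite big1 ?addr0 // => l nlm.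
    by rewrite eq_sym (negPf nlm) !mulr0.
  rewrite exchange_big; apply: eq_bigr => l _; rewrite (bigD1 m) //= eqxx.
  rewrite mulr1 mulrC big1 ?addr0 // => k nkm.
  by rewrite eq_sym (negPf nkm) !mulr0.
- move=> kl r c nc; case: (split_ordP r) => m ->.
    by rewrite !border_top /W (negPf nc).
  by rewrite ord1 !border_bot.
rewrite raddf_sum big1 //= => -[k l] _.
(* For k = l the syzygy is zero. *)
have [ekl|nkl] := eqVneq k l.
  rewrite (@det_col_scale _ _ (border (W (k, l))
    (fun c => if c == c0 then 0 else in_x (phi c))) _ c0 0)
    ?mul0r ?raddf0 // => r.
  rewrite mul0r; case: (split_ordP r) => m ->; last first.
    by rewrite ord1 border_bot eqxx.
  by rewrite border_top /W eqxx /v ekl subrr mulr0.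
rewrite (@det_border_koszul _ _ (@diffxy R n) _ _
  (fun c => in_y (phi0 c)) c0 k l (a k l)) //.
- rewrite raddfN /=; apply/eqP; rewrite oppr_eq0; apply/eqP.
  apply: (apply_xy_det_rows (r1 := rshift n ord0) (r2 := lshift 1 k)
    (D := fun c => E c - (c == c0)%:Z) (p := phi0) (q := phi0)).
  + by rewrite eq_rlshift.
  + move=> c; rewrite mxE /phi0 !eq_rlshift border_bot.
    by case: eqP => _; rewrite ?mul0r ?raddf0.
  + move=> c; rewrite mxE /phi0 eqxx eq_lshift (negPf nkl).
    by case: eqP => _; rewrite ?mul0r ?raddf0.
  + move=> r c; rewrite mxE; case: (split_ordP r) => m ->; last first.
      by rewrite ord1 eqxx.
    move=> _ /negPf ->; have [->|nc] := eqVneq c c0.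
      rewrite mulr_natl; case: (_ == _); rewrite ?mulr1n ?mulr0n; last 
        exact: deg_le0.
      exact: da.
    by rewrite subr0 border_top /W (negPf nc).
  move=> c1 c2 n12; rewrite /phi0.
  have [->|n1] := eqVneq c1 c0.
    by move=> ? ? _; left; rewrite mul0r raddf0.
  have [->|n2] := eqVneq c2 c0.
    by move=> ? ? _; right; rewrite mul0r raddf0.
  have -> : \sum_c (E c - (c == c0)%:Z) = \sum_c E c - 1.
    rewrite sumrB; congr (_ - _).
    by rewrite (bigD1 c0) //= eqxx big1 ?addr0 // => c /negPf ->.
  by rewrite !subr0; apply: kill.
- exact: lreg_diffxy.
- move=> c nc; rewrite /W /phi0 (negPf nc); exact: VE.
- by move=> m; rewrite /W eqxx.
- by rewrite eqxx.
Qed.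

Lemma apply_xy_border_col c0 V V' :
    (forall c, deg_quotients (E c) (phi c) (V c)) ->
    (forall c, deg_quotients (E c) (phi c) (V' c)) ->
    (forall c, c != c0 -> V c = V' c) ->
  apply_xy L1 L2 (\det (border V (fun c => in_x (phi c)))) =
  apply_xy L1 L2 (\det (border V' (fun c => in_x (phi c)))).
Proof.
move=> qV qV' VV'; pose W c k := if c == c0 then V c k - V' c k else V c k.
pose M b := if b then border V' (fun c => in_x (phi c)) else
  border W (fun c => if c == c0 then 0 else in_x (phi c)).
rewrite (det_col_sum (M := M) (c := c0)).
- rewrite big_bool raddfD /= [X in _ + X]apply_xy_border_syzygy ?addr0 //.
  + by move=> c nc; rewrite /quotients /W (negPf nc); case: (qV c).
  + under eq_bigr do rewrite /W eqxx mulrBr.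
    by rewrite sumrB (qV c0).1 (qV' c0).1 subrr.
  move=> c k; rewrite /W; case: eqP => _; last exact: (qV c).2.
  by apply: deg_leB; [exact: (qV c).2 | exact: (qV' c).2].
- move=> b r c nc; rewrite /M; case: b; case: (split_ordP r) => m ->;
    by rewrite ?border_top ?ord1 ?border_bot /W ?(negPf nc) ?VV'.
move=> r; rewrite big_bool /M; case: (split_ordP r) => m ->.
  by rewrite !border_top /W eqxx /= addrC subrK.
by rewrite ord1 !border_bot eqxx /= addr0.
Qed.

Lemma apply_xy_border_indep V V' :
    (forall c, deg_quotients (E c) (phi c) (V c)) ->
    (forall c, deg_quotients (E c) (phi c) (V' c)) ->
  apply_xy L1 L2 (\det (border V (fun c => in_x (phi c)))) =
  apply_xy L1 L2 (\det (border V' (fun c => in_x (phi c)))).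
Proof.
move=> qV qV'; pose W j (c : 'I_(n + 1)) := if (c < j)%N then V' c else V c.
have qW j c : deg_quotients (E c) (phi c) (W j c) by rewrite /W; case: ifP.
have W_step j : (j <= n + 1)%N ->
    apply_xy L1 L2 (\det (border V (fun c => in_x (phi c)))) =
    apply_xy L1 L2 (\det (border (W j) (fun c => in_x (phi c)))).
  elim: j => [_|j IHj lt_j].
    by congr (apply_xy _ _ (\det _)); apply/matrixP => r c; rewrite !mxE.
  rewrite (IHj (ltnW lt_j)).
  apply: (@apply_xy_border_col (Ordinal lt_j) _ _ (qW j) (qW j.+1)) => c.
  rewrite -val_eqE /W [(c < j.+1)%N]ltnS [(c <= j)%N]leq_eqVlt /=.
  by move=> /negPf ->.
rewrite (W_step _ (leqnn _)); congr (apply_xy _ _ (\det _)).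
by apply/matrixP => r c; rewrite !mxE /W ltn_ord.
Qed.

End Independence.

(** * The bordered determinants of f and F *)

Section RenamedDegree.
Variables (R : comNzRingType) (n : nat).

Let deg_le_rename (s : 'I_n -> 'I_(n + n)) d (p : {mpoly R[n]}) :
  deg_le d p -> deg_le d (p \mPo [tuple 'X_(s k) : {mpoly R[n + n]} | k < n]).
Proof.
move=> dp; rewrite comp_mpolyE big_seq.
apply: (big_ind (deg_le d)) => [||m /dp le_m].
- exact: deg_le0.
- by move=> *; apply: deg_leD.
apply/deg_leZ/(deg_leW le_m); rewrite mdegE (big_morph Posz PoszD (erefl 0%:Z)).
apply: deg_le_prod => i _; rewrite tnth_mktuple.
by have := @deg_leX R _ (U_(s i) *+ m i)%MM; rewrite mdegMn mdeg1 mul1n mpolyXn.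
Qed.

Lemma deg_le_in_x d (p : {mpoly R[n]}) : deg_le d p -> deg_le d (in_x p).
Proof. exact: deg_le_rename. Qed.

Lemma deg_le_in_y d (p : {mpoly R[n]}) : deg_le d p -> deg_le d (in_y p).
Proof. exact: deg_le_rename. Qed.

End RenamedDegree.

Section BorderedFunctional.
Variables (R : comNzRingType) (n : nat) (f : 'I_n -> {mpoly R[n]}).
Variables (e : 'I_n -> int) (d1 d2 : int) (L1 L2 : {scalar {mpoly R[n]}}).
Local Notation A := {mpoly R[n + n]}.

Definition extend T (s : 'I_n -> T) (t : T) (c : 'I_(n + 1)) : T :=
  match split c with inl i => s i | inr _ => t end.

Lemma extend_l T (s : 'I_n -> T) t i : extend s t (lshift 1 i) = s i.
Proof. by rewrite /extend (unsplitK (inl i)). Qed.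

Lemma extend_r T (s : 'I_n -> T) t : extend s t (rshift n ord0) = t.
Proof. by rewrite /extend (unsplitK (inr ord0)). Qed.

Lemma bordered_border ev nf D F :
  bordered ev f nf D F =
  border (extend (fun i k => nf i k) (fun k => D F k))
    (fun c => ev (extend f F c)).
Proof.
apply/matrixP => r c; rewrite /bordered.
case: (split_ordP r) => k ->; case: (split_ordP c) => i ->; rewrite ?ord1.
- by rewrite block_mxEul border_top extend_l mxE.
- by rewrite block_mxEur border_top extend_r mxE.
- by rewrite block_mxEdl border_bot extend_l mxE.
- by rewrite block_mxEdr border_bot extend_r mxE eqxx.
Qed.

Let delta_f := \sum_i (e i - 1).
Let top := delta_f + d1 + d2 + 1.
Hypotheses (d1_ge0 : 0 <= d1) (d2_ge0 : 0 <= d2).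
(* The bounds on the difference derivatives of the f i and, in the last column,
   of an F of degree at most top. *)
Let E := extend (fun i => e i - 1) (top - 1).

Definition annuls_multiples (L : {scalar {mpoly R[n]}}) d := forall i a,
  e i + (mdeg a)%:Z <= d -> L (f i * 'X_[a]) = 0.

Lemma sum_E : \sum_c E c = delta_f + (top - 1).
Proof.
rewrite big_split_ord big_ord1 /= /E extend_r; congr (_ + _).
by apply: eq_bigr => i _; rewrite extend_l.
Qed.

(** With two of the f's, if |a| + e_i > delta_f + d1 then
    |b| + e_j <= delta_f + d2.  With F and f_j, there remains
    |b| + e_j <= delta_f, and the condition on L2 alone suffices. *)
Lemma extended_products F : annuls_multiples L1 (delta_f + d1) ->
    annuls_multiples L2 (delta_f + d2) ->
  forall c1 c2, c1 != c2 ->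
  annul_products L1 L2 (\sum_c E c - 1 - E c1 - E c2)
    (extend f F c1) (extend f F c2).
Proof.
move=> A1 A2 c1 c2 n12 a b; rewrite sum_E /E /top.
case: (split_ordP c1) => i ei; case: (split_ordP c2) => j ej;
  rewrite ei ej ?ord1 ?extend_l ?extend_r => le_ab.
- have [le_a|lt_a] := leP (e i + (mdeg a)%:Z) (delta_f + d1).
    by left; apply: A1.
  by right; apply: A2; lia.
- by left; apply: A1; lia.
- by right; apply: A2; lia.
- by case/eqP: n12; rewrite ei ej !ord1.
Qed.

Lemma extended_quotients nf F v :
    (forall i, deg_quotients (e i - 1) (f i) (nf i)) ->
    deg_quotients (top - 1) F v ->
  forall c, deg_quotients (E c) (extend f F c) (extend nf v c).
Proof.
move=> qf qF c; rewrite /E; case: (split_ordP c) => i ->.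
  by rewrite !extend_l.
by rewrite ord1 !extend_r.
Qed.

(** The difference derivative of f_i g may be taken to be
    (nabla f_i) g(x) + f_i(y) nabla g; the column of f_i times g(x) then cancels
    the entry f_i(x) g(x) of the last row. *)
Lemma bordered_multiple nf i g w v :
    annuls_multiples L1 (delta_f + d1) -> annuls_multiples L2 (delta_f + d2) ->
    (forall i, deg_quotients (e i - 1) (f i) (nf i)) ->
    (forall j, deg_le (e j) (f j)) ->
    deg_le (top - e i) g -> deg_quotients (top - e i - 1) g w ->
    deg_quotients (top - 1) (f i * g) v ->
  apply_xy L1 L2 (\det (border (extend nf v)
    (fun c => in_x (extend f (f i * g) c)))) = 0.
Proof.
move=> A1 A2 qf df dg qg qF.
pose v' k := nf i k * in_x g + in_y (f i) * w k.
have q' : deg_quotients (top - 1) (f i * g) v'.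
  split; last first.
    move=> k; apply: deg_leD.
      have -> : top - 1 = e i - 1 + (top - e i) by ring.
      by apply: deg_leM; [exact: (qf i).2 | exact: deg_le_in_x].
    have -> : top - 1 = e i + (top - e i - 1) by ring.
    by apply: deg_leM; [exact: deg_le_in_y | exact: qg.2].
  rewrite /quotients /v'.
  under eq_bigr do rewrite mulrDr mulrA mulrCA.
  rewrite big_split /= -mulr_suml -mulr_sumr (qf i).1 qg.1 !in_xM !in_yM.
  by rewrite mulrBl mulrBr addrA subrK.
rewrite (@apply_xy_border_indep _ _ _ _ _ E _ _ (extend nf v')); first last.
- exact: extended_quotients.
- exact: extended_quotients.
- exact: extended_products.
(* V is left once the factor in_y (f i) of the last column is taken out; in W
   that factor sits in the last row instead, next to the values in x. *)
pose V := border (extend nf w) (fun c => in_x (extend f 0 c)).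
pose W : 'M[A]_(n + 1) := \matrix_(r, c)
  if r == rshift n ord0 then in_y (f i) * V r c else V r c.
pose last := rshift n (ord0 : 'I_1).
have -> : \det (border (extend nf v')
    (fun c => in_x (extend f (f i * g) c))) = \det W.
  rewrite (@det_row_scale _ _ V W last (in_y (f i))); first last.
  - by move=> c; rewrite mxE eqxx.
  - by move=> r c /negPf nr; rewrite mxE nr.
  pose M : 'M[A]_(n + 1) := \matrix_(r, c)
    if c == last then in_y (f i) * V r c else V r c.
  rewrite -(@det_col_scale _ _ V M last (in_y (f i))); first last.
  - by move=> r; rewrite mxE eqxx.
  - by move=> r c /negPf nc; rewrite mxE nc.
  pose x (c : 'I_(n + 1)) : A :=
    if c == last then 1 else if c == lshift 1 i then in_x g else 0.
  rewrite (@det_col_comb _ _ M _ last x) /x ?eqxx ?mul1r // => [r c|r].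
    case: (split_ordP c) => j ->; last by rewrite ord1 eqxx.
    move=> /negPf nc; rewrite [RHS]mxE nc.
    by case: (split_ordP r) => k ->;
      rewrite ?ord1 ?border_top ?border_bot !extend_l.
  rewrite big_split_ord big_ord1 /= -/last eqxx mul1r [M r last]mxE eqxx.
  rewrite (bigD1 i) //= eqxx [M r _]mxE /last eq_lrshift big1 ?addr0 => [|j nji].
    case: (split_ordP r) => k ->; rewrite ?ord1 ?border_top ?border_bot.
      by rewrite !extend_r !extend_l mulrC.
    by rewrite !extend_r !extend_l raddf0 mulr0 addr0 in_xM mulrC.
  by rewrite eq_lrshift eq_lshift (negPf nji) mul0r.
apply: (apply_xy_det_row (r0 := last)
  (D := extend (fun j => e j - 1) (top - e i - 1)) (p := extend f 0)
  (q := fun=> f i)).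
- by move=> c; rewrite mxE eqxx border_bot mulrC.
- move=> r c; rewrite mxE /last; case: (split_ordP r) => k ->; last first.
    by rewrite ord1 eqxx.
  move=> /negPf ->; rewrite border_top; case: (split_ordP c) => j ->.
    by rewrite !extend_l; case: (qf j).
  by rewrite ord1 !extend_r; case: qg.
move=> c; rewrite big_split_ord big_ord1 /= extend_r.
under eq_bigr do rewrite extend_l.
rewrite -/delta_f => a b; case: (split_ordP c) => j ->; last first.
  by move=> _; left; rewrite ord1 extend_r mul0r raddf0.
rewrite !extend_l /top => le_ab.
have [le_a|lt_a] := leP (e j + (mdeg a)%:Z) (delta_f + d1).
  by left; apply: A1.
by right; apply: A2; lia.
Qed.

(** The values in y are used in the last row: an L1 that vanishes in low degrees
    needs no multiple of the f's. *)
Lemma bordered_vanish_l nf F v :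
    (forall p, deg_le (delta_f + d1) p -> L1 p = 0) ->
    annuls_multiples L2 (delta_f + d2) ->
    (forall i, deg_quotients (e i - 1) (f i) (nf i)) ->
    deg_quotients (top - 1) F v ->
  apply_xy L1 L2
    (\det (border (extend nf v) (fun c => in_y (extend f F c)))) = 0.
Proof.
move=> A1 A2 qf qF.
apply: (apply_xy_det_row (r0 := rshift n ord0) (D := E) (p := fun=> 1)
  (q := extend f F)).
- by move=> c; rewrite border_bot /in_x rmorph1 mul1r.
- move=> r c; case: (split_ordP r) => k ->; last by rewrite ord1 eqxx.
  by rewrite border_top => _; case: (extended_quotients qf qF c).
move=> c a b; rewrite sum_E /E /top mul1r => le_ab.
have [le_a|lt_a] := leP (mdeg a)%:Z (delta_f + d1).
  by left; apply/A1/(deg_leW le_a)/deg_leX.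
right; move: le_ab; case: (split_ordP c) => j ->;
  rewrite ?ord1 ?extend_l ?extend_r => le_ab.
  by apply: A2; lia.
by lia.
Qed.

Lemma bordered_vanish_r nf F v :
    annuls_multiples L1 (delta_f + d1) ->
    (forall p, deg_le (delta_f + d2) p -> L2 p = 0) ->
    (forall i, deg_quotients (e i - 1) (f i) (nf i)) ->
    deg_quotients (top - 1) F v ->
  apply_xy L1 L2
    (\det (border (extend nf v) (fun c => in_x (extend f F c)))) = 0.
Proof.
move=> A1 A2 qf qF.
apply: (apply_xy_det_row (r0 := rshift n ord0) (D := E) (p := extend f F)
  (q := fun=> 1)).
- by move=> c; rewrite border_bot /in_y rmorph1 mulr1.
- move=> r c; case: (split_ordP r) => k ->; last by rewrite ord1 eqxx.
  by rewrite border_top => _; case: (extended_quotients qf qF c).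
move=> c a b; rewrite sum_E /E /top mul1r => le_ab.
have [le_b|lt_b] := leP (mdeg b)%:Z (delta_f + d2).
  by right; apply/A2/(deg_leW le_b)/deg_leX.
left; move: le_ab; case: (split_ordP c) => j ->;
  rewrite ?ord1 ?extend_l ?extend_r => le_ab.
  by apply: A1; lia.
by lia.
Qed.

End BorderedFunctional.

(** * Degrees with -oo and the hypotheses on L1 and L2 *)

Section Translation.
Variables (R : comNzRingType) (n : nat).
Implicit Types (f : 'I_n -> {mpoly R[n]}) (L : {scalar {mpoly R[n]}}).

Definition fin_degree (p : {mpoly R[n]}) : int := (msize p).-1%:Z.

Lemma total_degree_fin p : p != 0 -> total_degree p = Some (fin_degree p).
Proof. by rewrite /total_degree => /negPf ->. Qed.

Lemma delta_fin f : delta f =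
  if [forall i, f i != 0] then Some (\sum_i (fin_degree (f i) - 1)) else None.
Proof.
rewrite /delta.
have -> : [forall i, f i != 0] = all (fun i => f i != 0) (index_enum 'I_n).
  by apply/forallP/allP => [nzf i _|nzf i] //; apply: nzf; rewrite mem_index_enum.
elim: (index_enum _) => [|i r IHr]; first by rewrite !big_nil.
rewrite !big_cons IHr /=; have [f0|nz_f] := eqVneq (f i) 0.
  by rewrite /total_degree f0 eqxx.
by rewrite (total_degree_fin nz_f) /=; case: ifP.
Qed.

Lemma agree_upto_zero d (l l' : {scalar {mpoly R[n]}}) :
  (forall p : {mpoly R[n]}, degree_le (total_degree p) d -> p = 0) ->
  agree_upto d l l'.
Proof. by move=> d0 p /d0 ->; rewrite !raddf0. Qed.

Lemma annuls_bounded_ideal f d (l : {scalar {mpoly R[n]}}) :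
    (forall i g,
       degree_le (degree_add (total_degree (f i)) (total_degree g)) d ->
       l (f i * g) = 0) ->
  annuls l (bounded_ideal f d).
Proof.
by move=> lfg _ [g [dg ->]]; rewrite raddf_sum big1 // => i _; apply: lfg.
Qed.

Lemma annuls_multiples_of f L d : (forall i, f i != 0) ->
    annuls L (bounded_ideal f (Some d)) ->
  annuls_multiples f (fun i => fin_degree (f i)) L d.
Proof.
move=> nzf Lf i a le_d; apply: Lf.
exists (fun j => if j == i then 'X_[a] else 0); split=> [j|].
  case: eqP => [->|_]; last first.
    by rewrite /total_degree eqxx; case: (if _ then _ else _).
  by rewrite total_degreeX (total_degree_fin (nzf i)).
by rewrite (bigD1 i) //= eqxx big1 ?addr0 // => j /negPf ->; rewrite mulr0.
Qed.

Lemma deg_quotients_of (F : {mpoly R[n]})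
    (v : {ffun 'I_n -> {mpoly R[n + n]}}) d :
    degree_le (total_degree F) (Some d) -> is_diff_derivative F v ->
    monotonous F v ->
  deg_quotients (d - 1) F (fun k => v k).
Proof.
move=> le_d vF mv; split=> // k; apply/deg_leP.
have := mv k; case: (total_degree F) le_d => [t|] //= le_td.
  by case: (total_degree (v k)) => //= s /le_trans; apply; rewrite lerD2r.
by case: (total_degree (v k)).
Qed.

Lemma apply_xy_subl (L L' M : {scalar {mpoly R[n]}}) G :
  apply_xy (L \- L') M G = apply_xy L M G - apply_xy L' M G.
Proof. by []. Qed.

Lemma apply_xy_subr (L M M' : {scalar {mpoly R[n]}}) G :
  apply_xy L (M \- M') G = apply_xy L M G - apply_xy L M' G.
Proof.
rewrite /apply_xy -raddfB; congr (L _); rewrite /apply_y -sumrB.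
by apply: eq_bigr => m _; rewrite /= mulrBr scalerBl.
Qed.

Lemma det_border_xy (V : 'I_(n + 1) -> 'I_n -> {mpoly R[n + n]}) phi :
    (forall c, quotients (phi c) (V c)) ->
  \det (border V (fun c => in_x (phi c))) =
  \det (border V (fun c => in_y (phi c))).
Proof. exact: det_border_diff. Qed.

End Translation.

Theorem theorem3 (R : comNzRingType) (n : nat) (f : 'I_n -> {mpoly R[n]})
    (d1 d2 : int) (hd1 : 0 <= d1) (hd2 : 0 <= d2)
    (L1 L2 : {scalar {mpoly R[n]}})
    (hL1 : annuls L1 (bounded_ideal f (degree_add (delta f) (Some d1))))
    (hL2 : annuls L2 (bounded_ideal f (degree_add (delta f) (Some d2)))) :
  let top := degree_add (delta f) (Some (d1 + d2 + 1)) in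
  (* the two expressions of L are equal *)
  (forall (nf : 'I_n -> {ffun 'I_n -> {mpoly R[n + n]}})
     (D : {linear {mpoly R[n]} -> {ffun 'I_n -> {mpoly R[n + n]}}}),
     monotonous_diff_derivatives f nf ->
     monotonous_diff_operator D ->
     forall F, functional (@in_x R n) f nf D L1 L2 F
             = functional (@in_y R n) f nf D L1 L2 F) /\
  (* 1 *)
  (forall (nf nf' : 'I_n -> {ffun 'I_n -> {mpoly R[n + n]}})
     (D D' : {linear {mpoly R[n]} -> {ffun 'I_n -> {mpoly R[n + n]}}}),
     monotonous_diff_derivatives f nf ->
     monotonous_diff_operator D ->
     monotonous_diff_derivatives f nf' ->
     monotonous_diff_operator D' ->
     agree_upto top (functional (@in_x R n) f nf D L1 L2)
                    (functional (@in_x R n) f nf' D' L1 L2)) /\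
  (* 2 *)
  (forall (nf : 'I_n -> {ffun 'I_n -> {mpoly R[n + n]}})
     (D : {linear {mpoly R[n]} -> {ffun 'I_n -> {mpoly R[n + n]}}}),
     monotonous_diff_derivatives f nf ->
     monotonous_diff_operator D ->
     annuls (functional (@in_x R n) f nf D L1 L2) (bounded_ideal f top)) /\
  (* 3 *)
  (forall (nf : 'I_n -> {ffun 'I_n -> {mpoly R[n + n]}})
     (D : {linear {mpoly R[n]} -> {ffun 'I_n -> {mpoly R[n + n]}}}),
     monotonous_diff_derivatives f nf ->
     monotonous_diff_operator D ->
     forall L1' L2' : {scalar {mpoly R[n]}},
     agree_upto (degree_add (delta f) (Some d1)) L1 L1' ->
     agree_upto (degree_add (delta f) (Some d2)) L2 L2' ->
     agree_upto top (functional (@in_x R n) f nf D L1 L2)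
                    (functional (@in_x R n) f nf D L1' L2')).
Proof.
have detE (M1 M2 : {scalar {mpoly R[n]}}) ev nf D F :
    functional ev f nf D M1 M2 F = apply_xy M1 M2 (\det
      (border (extend (fun i k => nf i k) (fun k => D F k))
              (fun c => ev (extend f F c)))).
  by rewrite /functional bordered_border.
set top := degree_add _ (Some (d1 + d2 + 1)) => /=.
split.
  move=> nf D qf qD F.
  rewrite (detE L1 L2 (@in_x R n)) (detE L1 L2 (@in_y R n)).
  rewrite det_border_xy; [by [] | move=> c].
  case: (split_ordP c) => i ->; rewrite ?ord1 ?extend_l ?extend_r.
    exact: (qf i).1.
  exact: (qD F).1.
(* If some f i is 0 then top is -oo and only the zero polynomial is concerned. *)
have [/forallP nzf|f0] := boolP [forall i, f i != 0]; last first.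
  have top0 (p : {mpoly R[n]}) : degree_le (total_degree p) top -> p = 0.
    rewrite /top delta_fin (negPf f0) /= /total_degree.
    by case: eqP.
  split; last split.
  - by move=> nf nf' D D' _ _ _ _; exact: agree_upto_zero top0.
  - move=> nf D _ _; apply: annuls_bounded_ideal => i g.
    rewrite /top delta_fin (negPf f0) /= /total_degree.
    have [->|_] := eqVneq (f i) 0; first by rewrite mul0r raddf0.
    by have [->|_] := eqVneq g 0; rewrite ?mulr0 ?raddf0.
  - by move=> nf D _ _ L1' L2' _ _; exact: agree_upto_zero top0.
pose e i := fin_degree (f i); pose df := \sum_i (e i - 1).
have deltaE : delta f = Some df by rewrite delta_fin (introT forallP nzf).
have topE : top = Some (df + d1 + d2 + 1) by rewrite /top deltaE /= !addrA.
rewrite deltaE /= in hL1 hL2; rewrite topE deltaE.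
have de i : degree_le (total_degree (f i)) (Some (e i)).
  by rewrite (total_degree_fin (nzf i)) /= lexx.
have A1 := annuls_multiples_of nzf hL1; have A2 := annuls_multiples_of nzf hL2.
rewrite -/e in A1 A2.
have qfE nf : monotonous_diff_derivatives f nf ->
    forall i, deg_quotients (e i - 1) (f i) (fun k => nf i k).
  by move=> qf i; have [q m] := qf i; apply: deg_quotients_of (de i) q m.
have qDE (D : {linear {mpoly R[n]} -> {ffun 'I_n -> {mpoly R[n + n]}}}) d F :
    monotonous_diff_operator D ->
    degree_le (total_degree F) (Some d) ->
    deg_quotients (d - 1) F (fun k => D F k).
  by move=> qD dF; have [q m] := qD F; apply: deg_quotients_of dF q m.
split; last split.
- move=> nf nf' D D' qf qD qf' qD' F dF.
  rewrite /= (detE L1 L2 _ nf) (detE L1 L2 _ nf').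
  apply: (apply_xy_border_indep (extended_products hd1 hd2 _ A1 A2)).
    by apply: extended_quotients; [exact: qfE | exact: qDE].
  by apply: extended_quotients; [exact: qfE | exact: qDE].
- move=> nf D qf qD; apply: annuls_bounded_ideal => i g.
  have [->|nzg] := eqVneq g 0; first by rewrite mulr0 raddf0.
  rewrite (total_degree_fin (nzf i)) (total_degree_fin nzg) /= -/(e i) => le_g.
  have dgi : degree_le (total_degree g) (Some (df + d1 + d2 + 1 - e i)).
    by rewrite (total_degree_fin nzg) /= lerBrDl.
  rewrite /= detE.
  apply: (bordered_multiple hd1 hd2 A1 A2 (qfE nf qf) _ _ (qDE D _ _ qD dgi)).
  + by move=> j; apply/deg_leP.
  + exact/deg_leP.
  apply: qDE => //; apply/deg_leP.
  have -> : df + d1 + d2 + 1 = e i + (df + d1 + d2 + 1 - e i).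
    by rewrite addrCA subrr addr0.
  by apply: deg_leM; apply/deg_leP.
move=> nf D qf qD L1' L2' a1 a2 F dF; rewrite /= (detE L1 L2) (detE L1' L2').
have A1' : annuls_multiples f e L1' (df + d1).
  move=> i a le_d; rewrite -a1 ?A1 //; apply/deg_leP/(deg_leW le_d).
  by apply: deg_leM; [apply/deg_leP | apply: deg_leX].
have qF := qDE D _ F qD dF; have qf' := qfE nf qf.
(* L1 is replaced first, with the values in y in the last row, then L2, with the
   values in x; the second step uses that L1' still annuls the ideal. *)
have V1 (p : {mpoly R[n]}) : deg_le (df + d1) p -> (L1 \- L1') p = 0.
  by move=> dp; rewrite /= a1 ?subrr //; apply/deg_leP.
have V2 (p : {mpoly R[n]}) : deg_le (df + d2) p -> (L2 \- L2') p = 0.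
  by move=> dp; rewrite /= a2 ?subrr //; apply/deg_leP.
have := bordered_vanish_l hd1 hd2 V1 A2 qf' qF.
rewrite -det_border_xy; last by move=> c; case: (extended_quotients qf' qF c).
rewrite apply_xy_subl => /subr0_eq ->.
have := bordered_vanish_r hd1 hd2 A1' V2 qf' qF.
by rewrite apply_xy_subr => /subr0_eq.
Qed.
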